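(* Let $b>1$ be an integer. If $N$ is a Midy pseudoprime to base $b$, then $N$ is a strong pseudoprime to base $b$.
   Context: Let $b>1$ be an integer (the base of numeration). For a positive integer $M$ with $\gcd(M,b)=1$, $|b|_M$ denotes the multiplicative order of $b$ modulo $M$, i.e. the least positive integer $n$ with $b^n\equiv 1 \pmod M$, and $\mathbb{U}_M$ denotes the set of positive integers less than $M$ and relatively prime to $M$. For $x\in\mathbb{U}_M$, the base-$b$ expansion of $x/M$ is purely periodic with period of length $|b|_M$: $\frac{x}{M}=0.\overline{a_1a_2\cdots a_{|b|_M}}$, with $a_i$ base-$b$ digits. Midy's property: let $|b|_M=dk$ with $d,k$ positive integers and $d>1$. Split the period into $d$ blocks of length $k$, let $A_j=[a_{(j-1)k+1}a_{(j-1)k+2}\cdots a_{jk}]_b$ be the integer represented in base $b$ by the $j$-th block, and let $S_d(x)=\sum_{j=1}^d A_j$. One says $M$ has the Midy's property for $b$ and $d$ if $S_d(x)$ is a multiple of $b^k-1$ for all $x\in\mathbb{U}_M$. The set of all such $d$ (divisors $d>1$ of $|b|_M$ for which $M$ has the Midy's property for $b$ and $d$) is denoted $\mathcal{M}_b(M)$. An integer $M$ is a Midy pseudoprime to base $b$ if $M$ is an odd composite number relatively prime to both $b$ and $|b|_M$, and $d\in\mathcal{M}_b(M)$ for every divisor $d>1$ of $|b|_M$. An odd composite $M$ with $\gcd(b,M)=1$ and $M-1=2^r s$, $s$ odd, is a strong pseudoprime to base $b$ if either $b^s\equiv 1\pmod M$ or $b^{2^i s}\equiv -1\pmod M$ for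 some $0\le i<r$. *)

(* Defs.v *)
From mathcomp Require Import all_boot all_algebra all_solvable.

Set Implicit Arguments.
Unset Strict Implicit.
Unset Printing Implicit Defensive.

Lemma exists_mult_order b M :
  exists n, (0 < n) && (coprime b M ==> (b ^ n == 1 %[mod M])).
Proof.
case: M => [|M].
  exists 1; rewrite /=; apply/implyP; rewrite /coprime gcdn0 => /eqP ->.
  by rewrite exp1n.
exists (totient M.+1); rewrite totient_gt0 /=; apply/implyP => cop.
by apply/eqP; apply: Euler_exp_totient.
Qed.

(* |b|_M when b and M are coprime; the junk value is 1 otherwise. *)
Definition mult_order (b M : nat) : nat := ex_minn (exists_mult_order b M).

(* The i-th digit (i >= 1) after the radix point of x / M in base b, that is,
   floor (b ^ i * (x / M)) reduced modulo b. *)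
Definition digit (b M x i : nat) : nat := ((b ^ i * x) %/ M) %% b.

(* The integer [a_(j k + 1) ... a_(j k + k)]_b, most significant digit first.
   Blocks are numbered from j = 0. *)
Definition block (b M x k j : nat) : nat :=
  \sum_(i < k) digit b M x (j * k + i.+1) * b ^ (k - i.+1).

Definition block_sum (b M x d : nat) : nat :=
  \sum_(j < d) block b M x (mult_order b M %/ d) j.

(* The membership of d in the set M_b(M). *)
Definition midy_property (b M d : nat) : Prop :=
  [/\ 1 < d, d %| mult_order b M &
      forall x, 0 < x < M -> coprime x M ->
        b ^ (mult_order b M %/ d) - 1 %| block_sum b M x d].

Definition composite (M : nat) : Prop := 1 < M /\ ~~ prime M.

Definition midy_pseudoprime (b M : nat) : Prop :=
  [/\ odd M, composite M, coprime M b, coprime M (mult_order b M) &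
      forall d, 1 < d -> d %| mult_order b M -> midy_property b M d].

Definition strong_pseudoprime (b M : nat) : Prop :=
  [/\ odd M, composite M, coprime b M &
      exists r s : nat,
        [/\ M - 1 = 2 ^ r * s, odd s &
            b ^ s = 1 %[mod M] \/
            exists2 i, i < r & ((b ^ (2 ^ i * s))%:Z = - 1 %[mod M])%Z]].

(* Main.v *)
Require Import Defs.
From mathcomp Require Import all_boot all_algebra cyclic.

(** The proof rests on casting out nines in base [b ^ k].  The blocks of length
    [k] of the period of [1 / N] are the base [b ^ k] digits of
    [(b ^ o - 1) / N], where [o] is the order of [b] modulo [N]; hence their sum
    is congruent to that integer modulo [b ^ k - 1] ([block_sum_casting_out]).
    Midy's property at [d], where [o = d * k], therefore gives
    [N * (b ^ k - 1) %| b ^ o - 1], that is, [N] divides the geometric sum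
    [1 + b ^ k + ... + b ^ ((d - 1) * k)].  This sum is congruent to [d] modulo
    [b ^ k - 1], so a common divisor of [N] and [b ^ k - 1] divides [d], hence
    [o]; as [N] is coprime to [o], it follows that [N] is coprime to
    [b ^ k - 1] for every proper divisor [k] of [o] ([midy_coprime]).

    Two consequences finish the argument.  No prime [p] dividing [N] divides
    [b ^ k - 1] for a proper divisor [k] of [o], so [b] has order exactly [o]
    modulo [p]; by Fermat [o] divides [p - 1], and multiplying over the primes
    of [N], [o] divides [N - 1] ([order_dvd_pred]).  If [o] is even, then [N]
    divides [(b ^ (o / 2) - 1) * (b ^ (o / 2) + 1)] and is coprime to the first
    factor, so [b ^ (o / 2)] is [-1] modulo [N].  Writing [N - 1 = 2 ^ r * s]
    with [s] odd, the first alternative for strong pseudoprimes holds when [o]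
    is odd, since then [o] divides [s], and the second one holds when [o] is
    even, by raising [b ^ (o / 2)] to an odd power. *)

Lemma mult_order_gt0 b M : 0 < mult_order b M.
Proof. by rewrite /mult_order; case: ex_minnP => n /andP[]. Qed.

Lemma expn_mult_order b M : coprime b M -> b ^ mult_order b M = 1 %[mod M].
Proof.
rewrite /mult_order; case: ex_minnP => n /andP[_ /implyP h] _ co.
exact/eqP/h.
Qed.

(** Dividing the integer part of [b ^ n.+1 * x / M] by [b] leaves the integer
    part of [b ^ n * x / M] as quotient and the digit as remainder. *)
Lemma digit_rec b M x n : 0 < b ->
  (b ^ n.+1 * x) %/ M = (b ^ n * x) %/ M * b + digit b M x n.+1.
Proof.
move=> b0; rewrite {1}(divn_eq ((b ^ n.+1 * x) %/ M) b); congr (_ * b + _).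
by rewrite -divnMA (mulnC M) expnS -mulnA divnMl.
Qed.

Lemma digits_value b M x n k : 0 < b ->
  (b ^ (n + k) * x) %/ M =
    (b ^ n * x) %/ M * b ^ k
      + \sum_(i < k) digit b M x (n + i.+1) * b ^ (k - i.+1).
Proof.
move=> b0; elim: k => [|k IH]; first by rewrite big_ord0 addn0 expn0 muln1 addn0.
rewrite addnS digit_rec // IH big_ord_recr /= subnn expn0 muln1 addnS addnA.
congr (_ + _); rewrite mulnDl -mulnA -expnSr; congr (_ + _).
rewrite big_distrl /=; apply: eq_bigr => i _.
by rewrite -mulnA -expnSr subSS subnSK.
Qed.

Lemma block_value b M x k j : 0 < b ->
  (b ^ (j.+1 * k) * x) %/ M = (b ^ (j * k) * x) %/ M * b ^ k + block b M x k j.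
Proof. by move=> b0; rewrite mulSn addnC digits_value. Qed.

Lemma modn_pred_self m : 0 < m -> m = 1 %[mod m - 1].
Proof. by move=> m0; rewrite -{1}(subnK m0) modnDl. Qed.

(** Casting out nines: since [b ^ k] is [1] modulo [b ^ k - 1], the integer
    whose base [b ^ k] digits are the blocks is congruent to their sum. *)
Lemma block_sum_casting_out b M x k d : 0 < b -> x < M ->
  (b ^ (d * k) * x) %/ M = \sum_(j < d) block b M x k j %[mod b ^ k - 1].
Proof.
move=> b0 xM; have bk1 : b ^ k = 1 %[mod b ^ k - 1].
  by apply: modn_pred_self; rewrite expn_gt0 b0.
elim: d => [|d IH]; first by rewrite big_ord0 mul1n divn_small.
rewrite block_value // big_ord_recr /= -modnDml -modnMmr bk1 modnMmr muln1 IH.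
by rewrite modnDml.
Qed.

(** The casting-out criterion applied to [x = 1], for which the number formed
    by the whole period is [(b ^ o - 1) / M]. *)
Lemma midy_dvd b M d : 1 < b -> 1 < M -> coprime b M -> midy_property b M d ->
  M * (b ^ (mult_order b M %/ d) - 1) %| b ^ mult_order b M - 1.
Proof.
move=> b1 M1 co [d1 dvo midy]; set k := _ %/ d.
have /midy := coprime1n M; rewrite M1 => /(_ isT); rewrite -/k => dvS.
have dk : d * k = mult_order b M by rewrite mulnC divnK.
have := @block_sum_casting_out b M 1 k d (ltnW b1) M1.
rewrite dk muln1; move/eqP: dvS; rewrite /block_sum -/k => -> /eqP dvq.
have -> : b ^ mult_order b M - 1 = M * (b ^ mult_order b M %/ M).
  rewrite {1}(divn_eq (b ^ mult_order b M) M) expn_mult_order //.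
  by rewrite (modn_small M1) addnK mulnC.
by rewrite dvdn_pmul2l // ltnW.
Qed.

Lemma geometric_sum_mod B d : 0 < B -> \sum_(i < d) B ^ i = d %[mod B - 1].
Proof.
move=> B0; elim: d => [|d IH]; first by rewrite big_ord0.
rewrite big_ord_recr /= -modnDml IH modnDml -modnDmr -modnXm modn_pred_self //.
by rewrite modnXm exp1n modnDmr addn1.
Qed.

(** The quotient of [B ^ d - 1] by [B - 1] is a geometric sum, congruent to [d]
    modulo [B - 1]; so a common divisor of [N] and [B - 1] divides [d]. *)
Lemma coprime_of_dvd_geometric N B d : 1 < B -> coprime N d ->
  N * (B - 1) %| B ^ d - 1 -> coprime N (B - 1).
Proof.
move=> B1 co dv; have B0 := ltnW B1.
have dvsum : N %| \sum_(i < d) B ^ i.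
  rewrite -(@dvdn_pmul2l (B - 1)) ?subn_gt0 //.
  by rewrite mulnC (subn1 B) -predn_exp -!subn1.
have dvd : gcdn N (B - 1) %| d.
  have : gcdn N (B - 1) %| \sum_(i < d) B ^ i := dvdn_trans (dvdn_gcdl _ _) dvsum.
  rewrite /dvdn -(modn_dvdm _ (dvdn_gcdr N (B - 1))) geometric_sum_mod //.
  by rewrite modn_dvdm // dvdn_gcdr.
by rewrite /coprime -dvdn1 -[X in _ %| X](eqP co) dvdn_gcd dvdn_gcdl.
Qed.

(** Here coprimality of [N] with the order rules out the factors that [N] and
    [b ^ k - 1] may otherwise share under Midy's property. *)
Lemma midy_coprime b N k : 1 < b -> midy_pseudoprime b N ->
  k %| mult_order b N -> k < mult_order b N -> coprime N (b ^ k - 1).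
Proof.
move=> b1 [_ [N1 _] co coo midy] kdv klt.
have o0 := mult_order_gt0 b N; have k0 : 0 < k := dvdn_gt0 o0 kdv.
have okd := divnK kdv; set d := _ %/ k in okd.
have d1 : 1 < d by rewrite /d ltn_divRL // mul1n.
have ddv : d %| mult_order b N by rewrite -okd dvdn_mulr.
have d0 := ltnW d1.
have ok : mult_order b N %/ d = k by rewrite -okd mulKn.
have co' : coprime b N by rewrite coprime_sym.
have := midy_dvd b N d b1 N1 co' (midy d d1 ddv).
rewrite ok -[in X in _ %| X]okd (mulnC d) expnM.
apply: coprime_of_dvd_geometric; last exact: coprime_dvdr ddv coo.
by rewrite -[X in X < _](exp1n k) ltn_exp2r.
Qed.

Lemma expn_gcd_eq1 b m n p : 0 < m ->
  b ^ m = 1 %[mod p] -> b ^ n = 1 %[mod p] -> b ^ gcdn m n = 1 %[mod p].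
Proof.
move=> m0 bm bn; have powM e i : b ^ e = 1 %[mod p] -> b ^ (i * e) = 1 %[mod p].
  by move=> be; rewrite mulnC expnM -modnXm be modnXm exp1n.
case: (egcdnP n m0) => km kn eqk _.
have := powM m km bm; rewrite eqk expnD -modnMml powM //.
by rewrite modnMml mul1n.
Qed.

Lemma eq1_mod_prod N m : 0 < N ->
  (forall p, prime p -> p %| N -> p = 1 %[mod m]) -> N = 1 %[mod m].
Proof.
move=> N0 hp; rewrite (prod_prime_decomp N0) prime_decompE big_map big_seq.
elim/big_ind: _ => [//|x y hx hy|p]; first by rewrite -modnMm hx hy modnMm.
rewrite mem_primes => /and3P[pp _ pN] /=.
by rewrite -modnXm (hp p) // modnXm exp1n.
Qed.

(** Modulo a prime [p] dividing [N], the base has order exactly [m]: the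
    [gcdn m (p - 1)]-th power of [b] is [1] modulo [p], which the coprimality
    hypothesis forbids unless this exponent is [m].  So every prime factor of
    [N] is [1] modulo [m], and so is [N]. *)
Lemma order_dvd_pred b N m : 0 < b -> 0 < N -> 0 < m -> coprime b N ->
  b ^ m = 1 %[mod N] ->
  (forall k, k %| m -> k < m -> coprime N (b ^ k - 1)) -> m %| N - 1.
Proof.
move=> b0 N0 m0 co bm hco; rewrite -eqn_mod_dvd //; apply/eqP.
apply: eq1_mod_prod => // p pp pN; have p0 := prime_gt0 pp.
apply/eqP; rewrite eqn_mod_dvd //.
have bp : b ^ (p - 1) = 1 %[mod p].
  by rewrite subn1 -totient_prime //; apply/Euler_exp_totient/(coprime_dvdr pN).
have bmp : b ^ m = 1 %[mod p] by rewrite -(modn_dvdm _ pN) bm modn_dvdm.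
have /eqP := expn_gcd_eq1 b m (p - 1) p m0 bmp bp.
rewrite eqn_mod_dvd ?expn_gt0 ?b0 // => pdv.
have := dvdn_leq m0 (dvdn_gcdl m (p - 1)).
rewrite leq_eqVlt => /predU1P[<-|glt]; first exact: dvdn_gcdr.
have pco := coprime_dvdl pN (hco _ (dvdn_gcdl _ _) glt).
by move: pp; have := gcdn_idPl pdv; rewrite (eqP pco) => <-.
Qed.

(** A square root [a] of [1] modulo [N] with [a - 1] coprime to [N] is [-1];
    its odd powers are all congruent to [a]. *)
Lemma odd_power_eqN1 a N t : 0 < a -> odd t -> a ^ 2 = 1 %[mod N] ->
  coprime N (a - 1) -> N %| a ^ t + 1.
Proof.
move=> a0 todd a2 co.
have dva : N %| a + 1.
  rewrite -(Gauss_dvdr _ co) -subn_sqr exp1n -eqn_mod_dvd ?expn_gt0 ?a0 //.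
  exact/eqP.
rewrite -(odd_double_half t) todd -mul2n expnD expn1 expnM.
rewrite /dvdn -modnDml -modnMmr -modnXm a2 modnXm exp1n modnMmr muln1 modnDml.
exact: dva.
Qed.

Theorem theorem18 (b N : nat) (hb : 1 < b) (hN : midy_pseudoprime b N) :
  strong_pseudoprime b N.
Proof.
have [Nodd [N1 Ncomp] co _ _] := hN; have co' : coprime b N by rewrite coprime_sym.
split=> //; set o := mult_order b N.
have o0 : 0 < o := mult_order_gt0 b N.
have bo : b ^ o = 1 %[mod N] by apply: expn_mult_order.
have hco k : k %| o -> k < o -> coprime N (b ^ k - 1) by apply: midy_coprime.
have odv : o %| N - 1 by apply: order_dvd_pred hco => //; apply: ltnW.
have Np0 : 0 < N - 1 by rewrite subn_gt0.
have [s cos Ns] := @pfactor_coprime 2 _ isT Np0.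
have [u cou ou] := @pfactor_coprime 2 _ isT o0.
move: (logn 2 (N - 1)) (logn 2 o) Ns ou => r e Ns ou.
rewrite coprime2n in cos; rewrite coprime2n in cou.
have us : u %| s.
  rewrite -(@Gauss_dvdl u s (2 ^ r)); last by rewrite coprimeXr // coprimen2.
  by rewrite -Ns; apply: dvdn_trans odv; rewrite ou dvdn_mulr.
have er : e <= r.
  rewrite -(@dvdn_Pexp2l 2) // -(@Gauss_dvdr _ s); last first.
    by rewrite coprimeXl // coprime2n.
  by rewrite -Ns; apply: dvdn_trans odv; rewrite ou dvdn_mull.
exists r, s; split=> //; first by rewrite mulnC.
have [t st] := dvdnP us.
case: e ou er => [|e] ou er.
  left; rewrite st -(muln1 u) -(expn0 2) -ou mulnC expnM.
  by rewrite -modnXm bo modnXm exp1n.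
right; exists e => //.
have [h oh hE] : exists2 h, o = h * 2 & 2 ^ e * s = h * t.
  exists (u * 2 ^ e); first by rewrite ou expnSr mulnA.
  by rewrite st mulnC -mulnA mulnC.
have todd : odd t by move: cos; rewrite st oddM => /andP[].
have h0 : 0 < h by move: o0; rewrite oh muln_gt0 => /andP[].
apply/eqP; rewrite eqz_mod_dvd GRing.opprK hE expnM.
apply: (@odd_power_eqN1 (b ^ h)) => //.
- by rewrite expn_gt0 ltnW.
- by rewrite -expnM -oh.
- by apply: hco; rewrite oh ?dvdn_mulr // ltn_Pmulr.
Qed.
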